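(* Let $G$ be an $n$-dimensional Lie group with identity $e$ and Lie algebra $\mathfrak{g}$, endowed with a left-invariant Riemannian metric $\langle\cdot,\cdot\rangle$, and let $\mathbb{I}$ be the corresponding inner product on $\mathfrak{g}$. Let $E_1,\dots,E_m\in\mathfrak{g}$ be linearly independent ($m\le n$), let $\mathcal{D}_e=\mathrm{span}\{E_1,\dots,E_m\}$, let $\mathcal{D}$ be the distribution on $G$ generated by the left-invariant vector fields $E_1^L,\dots,E_m^L$, and complete to a basis $\{E_1,\dots,E_n\}$ of $\mathfrak{g}$ with $E_{m+1},\dots,E_n\in\mathcal{D}_e^{\perp}$ (orthogonal complement with respect to $\mathbb{I}$), with dual basis $\{E_1^*,\dots,E_n^*\}$ of $\mathfrak{g}^*$. Assume that the affine connection control system $(G,\langle\cdot,\cdot\rangle,\mathcal{D})$ is small-time locally controllable for every proper control set. Let $L\in C^\infty(G\times\mathfrak{g}\times\mathcal{D}_e)$ be a cost function and consider the optimal control problem of minimizing $\int_0^T L(x(t),y(t),u(t))\,dt$ subject to $$\frac{dx}{dt}=T_eL_x y,\qquad \frac{dy}{dt}=u+\mathbb{I}^{\sharp}ad_y^*\mathbb{I}^{\flat}y,\qquad u(t)\in\mathcal{D}_e,$$ with prescribed values of $(x,y)$ at $t=0$ and $t=T$. Then the critical trajectories $(x,y;\mu,\xi,u)$ of this problem, which are curves in $G\times\mathfrak{g}\times\mathfrak{g}^*\times\mathfrak{g}^*\times\mathcal{D}_e$ (as defined in the context by means of the symplectic equation $i_{\sigma_H}\Omega=dH$), satisfy the equations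 $$\frac{dx}{dt}=T_eL_x y,\qquad \frac{dy}{dt}=u+\mathbb{I}^{\sharp}ad_y^*\mathbb{I}^{\flat}y,$$ $$\frac{d\mu}{dt}=T_e^*L_x\frac{\delta L}{\delta x}+ad_y^*\mu,\qquad \frac{d\xi}{dt}=-\mu+\frac{\delta L}{\delta y}-\mathbb{I}^{\flat}ad_y\mathbb{I}^{\sharp}\xi+ad^*_{\mathbb{I}^{\sharp}\xi}\mathbb{I}^{\flat}y,$$ $$0=\xi^{\mathcal{D}_e}-\frac{\delta L}{\delta u},$$ where, for $\xi=\sum_{i=1}^n\xi_iE_i^*\in\mathfrak{g}^*$, $\xi^{\mathcal{D}_e}=\sum_{a=1}^m\xi_aE_a^*\in\mathbb{I}^{\flat}\mathcal{D}_e$, and the partial derivatives of $L$ are evaluated at $(x,y,u)$.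
   Context: **Notation.** $L_x:G\to G$ is left translation by $x$ (not to be confused with the cost function $L$); $T_eL_x:\mathfrak{g}\to T_xG$ is its tangent map at $e$, and $T_e^*L_x:T_x^*G\to\mathfrak{g}^*$ is the dual map of $T_eL_x$. $E^L$ is the left-invariant vector field determined by $E\in\mathfrak{g}$. $ad_yz=[y,z]$, and $ad_y^*:\mathfrak{g}^*\to\mathfrak{g}^*$ is the dual map, $(ad_y^*\mu)(z)=\mu([y,z])$. $\mathbb{I}^{\flat}:\mathfrak{g}\to\mathfrak{g}^*$, $\mathbb{I}^{\flat}(y)(z)=\mathbb{I}(y,z)$, and $\mathbb{I}^{\sharp}=(\mathbb{I}^{\flat})^{-1}$. For a smooth function $f$ of variables $x\in G$, $y\in\mathfrak{g}$, $\mu,\xi\in\mathfrak{g}^*$, $u\in\mathcal{D}_e$, the partial functional derivatives are the partial differentials $\frac{\delta f}{\delta x}\in T_x^*G$, $\frac{\delta f}{\delta y}\in\mathfrak{g}^*$, $\frac{\delta f}{\delta\mu},\frac{\delta f}{\delta\xi}\in\mathfrak{g}$ (identifying $\mathfrak{g}^{**}=\mathfrak{g}$), and $\frac{\delta f}{\delta u}\in\mathcal{D}_e^*$. Here $\mathcal{D}_e^*$ is identified with $\mathrm{span}\{E_1^*,\dots,E_m^*\}=\mathbb{I}^{\flat}\mathcal{D}_e\subset\mathfrak{g}^*$, i.e. $\frac{\delta f}{\delta u}=\sum_{a=1}^m\frac{\partial f}{\partial u_a}E_a^*$ for $u=\sum_a u_aE_a$. **Affine connection control system.** $(G,\langle\cdot,\cdot\rangle,\mathcal{D})$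 denotes the control system $\frac{D^2x}{dt^2}(t)=\sum_{a=1}^m u_a(t)E_a^L(x(t))$, with covariant acceleration defined by the Levi-Civita connection of $\langle\cdot,\cdot\rangle$. The controls take values in $\mathbb{R}^m$, and $\mathbb{R}^m$ is identified with $\mathcal{D}_e$ through $(u_a)\mapsto\sum_a u_aE_a$. Writing $y=(T_eL_x)^{-1}\dot x$ (body velocity), the system is represented by $\dot x=T_eL_xy$, $\dot y=\mathbb{I}^{\sharp}ad_y^*\mathbb{I}^{\flat}y+u$. A control set $U\subset\mathbb{R}^m$ is proper if $0$ is in the interior of its convex hull. The system with control set $U$ is small-time locally controllable if, for every $x_0\in G$, the set of states in $TG$ reachable from the zero vector $0_{x_0}$ in time at most $t$ with $U$-valued controls contains $0_{x_0}$ in its interior for all sufficiently small $t>0$. The cost function arises as $L(x,y,u)=\mathbb{L}(T_eL_xy,u)$ from a cost function $\mathbb{L}$ of the velocity $v_x=T_eL_xy\in T_xG$ and the control $u\in\mathcal{D}_e$. **Lie algebroid.** The trivial bundle $G\times 3\mathfrak{g}\to G\times\mathfrak{g}$, with elements $(x,y;z,w)$, is a Lie algebroid with anchor $\rho(x,y;z,w)=(T_eL_xz,w)$ and bracket of constant sections $[c_{(z_1,w_1)},c_{(z_2,w_2)}]=c_{([z_1,z_2],0)}$, extended by the Leibniz identity. Its dual bundle is $G\times\mathfrak{g}\times2\mathfrak{g}^*$, with elements $p=(x,y;\mu,\xi)$. (Here $k\mathfrak{g}$ and $k\mathfrak{g}^*$ are the $k$-fold products.) The prolongation of the dual bundle with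 respect to this Lie algebroid is identified with $\mathcal{T}=(G\times\mathfrak{g}\times2\mathfrak{g}^* )\times(2\mathfrak{g}\times2\mathfrak{g}^* )$, a Lie algebroid over $G\times\mathfrak{g}\times2\mathfrak{g}^*$ with anchor $$\rho_{\mathcal{T}}(x,y;\mu,\xi;z,w;v_\mu,v_\xi)=(T_eL_xz,w;v_\mu,v_\xi)\in T_{(x,y;\mu,\xi)}(G\times\mathfrak{g}\times2\mathfrak{g}^* ).$$ Its canonical symplectic form is $$\Omega_{(x,y;\mu,\xi)}\big((z,w;v_\mu,v_\xi),(z',w';v'_\mu,v'_\xi)\big)=v'_\mu(z)+v'_\xi(w)-\big(v_\mu(z')+v_\xi(w')\big)+\mu([z,z']).$$ Similarly, the prolongation of $G\times\mathfrak{g}\times2\mathfrak{g}^*\times\mathcal{D}_e$ is $\widetilde{\mathcal{T}}=(G\times\mathfrak{g}\times2\mathfrak{g}^*\times\mathcal{D}_e)\times(2\mathfrak{g}\times2\mathfrak{g}^*\times\mathcal{D}_e)$ with anchor sending $(x,y;\mu,\xi,u;z,w;v_\mu,v_\xi,v_u)$ to $(T_eL_xz,w;v_\mu,v_\xi,v_u)$. **Hamiltonian and critical trajectories.** The control system is the section $\sigma(x,y,u)=(x,y;y,u+\mathbb{I}^{\sharp}ad_y^*\mathbb{I}^{\flat}y)$ of $G\times3\mathfrak{g}$ along the projection $G\times\mathfrak{g}\times\mathcal{D}_e\to G\times\mathfrak{g}$. The Hamiltonian function $H:G\times\mathfrak{g}\times2\mathfrak{g}^*\times\mathcal{D}_e\to\mathbb{R}$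 is $$H(x,y;\mu,\xi,u)=\mu(y)+\xi\big(u+\mathbb{I}^{\sharp}ad_y^*\mathbb{I}^{\flat}y\big)-L(x,y,u).$$ The Hamiltonian control system $\sigma_H$ is the section of $\mathcal{T}$ along $\mathrm{pr}_1:(x,y;\mu,\xi,u)\mapsto(x,y;\mu,\xi)$ solving the symplectic equation $i_{\sigma_H}\Omega=d^{\widetilde{\mathcal{T}}}H$. That is, at a point $a=(x,y;\mu,\xi,u)$ with $p=\mathrm{pr}_1(a)$, $$\Omega_p\big(\sigma_H(a),(z',w';v'_\mu,v'_\xi)\big)=dH_a\big(T_eL_xz',w',v'_\mu,v'_\xi,v'_u\big)\quad\text{for all }(z',w',v'_\mu,v'_\xi,v'_u)\in2\mathfrak{g}\times2\mathfrak{g}^*\times\mathcal{D}_e.$$ It is defined on the set $W$ of points $a$ where this equation has a solution, namely the points where $dH_a$ vanishes on all vectors $(0,0,0,0,v'_u)$, $v'_u\in\mathcal{D}_e$. The critical trajectories of the optimal control problem are the integral curves of $\rho_{\mathcal{T}}(\sigma_H)$, i.e. the curves $a(t)=(x,y;\mu,\xi,u)(t)$ in $W$ such that $\frac{d}{dt}(\mathrm{pr}_1\circ a)(t)=\rho_{\mathcal{T}}(\sigma_H(a(t)))$. *)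

(* Defs.v *)
From HB Require Import structures.
From mathcomp Require Import all_boot all_order all_algebra.
From mathcomp Require Import all_classical all_reals all_analysis.

Set Implicit Arguments.
Unset Strict Implicit.
Unset Printing Implicit Defensive.
Import Order.TTheory GRing.Theory Num.Theory.
Import numFieldNormedType.Exports.
Local Open Scope classical_set_scope.
Local Open Scope ring_scope.

(* U is always open and V finite-dimensional below.  'd f x v is only
   meaningful where f is differentiable, which the clause for k.+1 asserts. *)
Fixpoint Ck (k : nat) (R : realType) (V W : normedModType R)
    (U : set V) (f : V -> W) : Prop :=
  if k is k'.+1 then
    (forall x, U x -> differentiable f x) /\
    (forall v, Ck k' U (fun x => 'd f x v))
  else forall x, U x -> {for x, continuous f}.

Definition smooth (R : realType) (V W : normedModType R)
  (U : set V) (f : V -> W) : Prop := forall k, Ck k U f.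

(* The atlas is indexed by the points of G: chart p is a chart around p, with
   domain chart_dom p and inverse chart_inv p; outside the domain (resp. the
   image) the values of these total functions are irrelevant. *)
HB.mixin Record isLieGroup (R : realType) (n : nat) G
    of Topological G & Group G := {
  chart : G -> G -> 'rV[R]_n;
  chart_dom : G -> set G;
  chart_inv : G -> 'rV[R]_n -> G;
  lie_hausdorff : hausdorff_space G;
  lie_second_countable : @second_countable G;
  chart_dom_open : forall p, open (chart_dom p);
  chart_dom_center : forall p, chart_dom p p;
  chart_im_open : forall p, open (chart p @` chart_dom p);
  chartK : forall p x, chart_dom p x -> chart_inv p (chart p x) = x;
  chart_continuous : forall p x, chart_dom p x -> {for x, continuous (chart p)};
  chart_inv_continuous : forall p a, (chart p @` chart_dom p) a ->
    {for a, continuous (chart_inv p)};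
  chart_transition : forall p q,
    smooth [set a | (chart p @` chart_dom p) a /\ chart_dom q (chart_inv p a)]
      (fun a => chart q (chart_inv p a));
  lie_mul_continuous : continuous (fun xy : G * G => (xy.1 * xy.2)%g);
  lie_mul_smooth : forall p q r,
    smooth [set ab : 'rV[R]_n * 'rV[R]_n |
             [/\ (chart p @` chart_dom p) ab.1, (chart q @` chart_dom q) ab.2
               & chart_dom r (chart_inv p ab.1 * chart_inv q ab.2)%g]]
      (fun ab => chart r (chart_inv p ab.1 * chart_inv q ab.2)%g);
  lie_inv_continuous : continuous (fun x : G => (x^-1)%g);
  lie_inv_smooth : forall p q,
    smooth [set a | (chart p @` chart_dom p) a /\
                    chart_dom q ((chart_inv p a)^-1)%g]
      (fun a => chart q ((chart_inv p a)^-1)%g)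
}.

#[short(type="lieGroupType")]
HB.structure Definition LieGroup (R : realType) (n : nat) :=
  {G of isLieGroup R n G & Topological G & Group G}.

Section Manifold.
Context {R : realType} {n : nat} {G : lieGroupType R n}.

Definition chart_im (p : G) : set 'rV[R]_n := chart p @` chart_dom p.

(* Every tangent space T_x G is 'rV_n: a tangent vector at x is given by its
   coordinates in the preferred chart x.  tcoord p x and tlift p x convert
   between T_x G and coordinates in the chart p (for x in its domain). *)
Definition tcoord (p x : G) (v : 'rV[R]_n) : 'rV[R]_n :=
  'd (fun a => chart p (chart_inv x a)) (chart x x) v.

Definition tlift (p x : G) (v : 'rV[R]_n) : 'rV[R]_n :=
  'd (fun a => chart x (chart_inv p a)) (chart p x) v.

Definition tangent_map (f : G -> G) (x : G) (v : 'rV[R]_n) : 'rV[R]_n :=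
  'd (fun a => chart (f x) (f (chart_inv x a))) (chart x x) v.

Definition TeL (x : G) : 'rV[R]_n -> 'rV[R]_n :=
  tangent_map (fun y => x * y)%g 1%g.

Definition left_field (z : 'rV[R]_n) (x : G) : 'rV[R]_n := TeL x z.

Definition field_coord (p : G) (X : G -> 'rV[R]_n) (a : 'rV[R]_n) :=
  tcoord p (chart_inv p a) (X (chart_inv p a)).

(* [X, Y]^k = X^i d_i Y^k - Y^i d_i X^k, computed at p in the chart p, where
   coordinates of vectors at p and elements of T_p G coincide. *)
Definition field_bracket (X Y : G -> 'rV[R]_n) (p : G) : 'rV[R]_n :=
  'd (field_coord p Y) (chart p p) (X p)
  - 'd (field_coord p X) (chart p p) (Y p).

Definition ad (z w : 'rV[R]_n) : 'rV[R]_n :=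
  field_bracket (left_field z) (left_field w) 1%g.

(* Covectors are columns, acting on tangent vectors (rows) by pairing. *)
Definition pairing (alpha : 'cV[R]_n) (v : 'rV[R]_n) : R := (v *m alpha) 0 0.

(* The covector representing a linear form f. *)
Definition covec (f : 'rV[R]_n -> R) : 'cV[R]_n :=
  \col_k f (delta_mx 0 k).

Definition TeL_dual (x : G) (alpha : 'cV[R]_n) : 'cV[R]_n :=
  covec (fun z => pairing alpha (TeL x z)).

Definition ad_dual (z : 'rV[R]_n) (mu : 'cV[R]_n) : 'cV[R]_n :=
  covec (fun w => pairing mu (ad z w)).

(* Derivatives relative to a time set J: one-sided at its endpoints. *)
Definition deriv_within (V : normedModType R) (J : set R) (f : R -> V)
    (t : R) (v : V) : Prop :=
  (fun s => (s - t)^-1 *: (f s - f t)) @ within J t^' --> v.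

Definition velocity_within (J : set R) (x : R -> G) (t : R) (v : 'rV[R]_n)
    : Prop :=
  x @ within J (nbhs t) --> x t /\
  deriv_within J (fun s => chart (x t) (x s)) t v.

End Manifold.

Section Metric.
Context {R : realType} {n : nat}.

Definition metric_coef (G : lieGroupType R n) (g : G -> 'rV[R]_n -> 'rV[R]_n -> R)
    (p : G) (a : 'rV[R]_n) : 'M[R]_n :=
  let x := chart_inv p a in
  \matrix_(i, j) g x (tlift p x (delta_mx 0 i)) (tlift p x (delta_mx 0 j)).

Record riemannian_metric (G : lieGroupType R n) := RiemannianMetric {
  metric :> G -> 'rV[R]_n -> 'rV[R]_n -> R;
  metric_linear : forall x c v v' w,
    metric x (c *: v + v') w = c * metric x v w + metric x v' w;
  metric_sym : forall x v w, metric x v w = metric x w v;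
  metric_pos : forall x v, v != 0 -> 0 < metric x v v;
  metric_smooth : forall p i j,
    smooth (chart_im p) (fun a => metric_coef metric p a i j)
}.

Context {G : lieGroupType R n}.

Definition left_invariant (g : riemannian_metric G) : Prop :=
  forall x y v w,
    g (x * y)%g (tangent_map (fun z => x * z)%g y v)
                (tangent_map (fun z => x * z)%g y w) = g y v w.

Variable g : riemannian_metric G.

Definition inertia : 'rV[R]_n -> 'rV[R]_n -> R := g 1%g.

Definition flat (y : 'rV[R]_n) : 'cV[R]_n := covec (inertia y).

Definition inertia_mx : 'M[R]_n :=
  \matrix_(i, j) inertia (delta_mx 0 i) (delta_mx 0 j).

(* The inverse of flat: flat y = inertia_mx *m y^T, inertia_mx symmetric. *)
Definition sharp (mu : 'cV[R]_n) : 'rV[R]_n := (invmx inertia_mx *m mu)^T.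

(* Levi-Civita connection in the chart p: christoffel p a k i j is
   Gamma^k_ij = 1/2 g^kl (d_i g_jl + d_j g_il - d_l g_ij) at a. *)
Definition christoffel (p : G) (a : 'rV[R]_n) (k i j : 'I_n) : R :=
  let dg l i' j' :=
    'd (fun b => metric_coef g p b i' j' : R^o) a (delta_mx 0 l) in
  2^-1 * \sum_l invmx (metric_coef g p a) k l *
           (dg i j l + dg j i l - dg l i j).

End Metric.

Section ControlSystem.
Context {R : realType} {n m : nat} {G : lieGroupType R n}.
Variables (g : riemannian_metric G) (E : 'I_m -> 'rV[R]_n).

(* The identification of R^m with D_e = span E.  Throughout, an element of
   D_e is represented by its coordinates u : 'rV_m in the basis E. *)
Definition ctrl (u : 'rV[R]_m) : 'rV[R]_n := \sum_a u 0 a *: E a.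

(* dv/dt = accel p x v u is the equation D^2 x / dt^2 = sum_a u_a E_a^L(x)
   in the chart p; v is the velocity in T_x G. *)
Definition accel (p x : G) (v : 'rV[R]_n) (u : 'rV[R]_m) : 'rV[R]_n :=
  let vp := tcoord p x v in
  \sum_a u 0 a *: tcoord p x (left_field (E a) x)
  - \row_k \sum_i \sum_j christoffel g p (chart p x) k i j * vp 0 i * vp 0 j.

(* Caratheodory solutions on [0, T] for Lebesgue-integrable controls; v t is
   the velocity of x at t. *)
Definition controlled_trajectory (T : R) (u : R -> 'rV[R]_m)
    (x : R -> G) (v : R -> 'rV[R]_n) : Prop :=
  [/\ forall a, lebesgue_measure.-integrable `[0, T]
        (fun t : R => (u t 0 a)%:E),
      forall t, `[0, T]%classic t -> velocity_within `[0, T] x t (v t) &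
      forall p s t, 0 <= s -> s <= t -> t <= T ->
        (forall r, `[s, t]%classic r -> chart_dom p (x r)) ->
        forall k,
          let f := fun r : R => accel p (x r) (v r) (u r) 0 k in
          lebesgue_measure.-integrable `[s, t] (fun r => (f r)%:E) /\
          tcoord p (x t) (v t) 0 k - tcoord p (x s) (v s) 0 k
          = \int[lebesgue_measure]_(r in `[s, t]) f r].

(* States of TG are pairs (x, v) with v : T_x G. *)
Definition reachable (U : set 'rV[R]_m) (x0 : G) (t : R)
    : set (G * 'rV[R]_n) :=
  [set xv | exists T u x v, [/\ 0 <= T, T <= t,
     forall r, `[0, T]%classic r -> U (u r),
     controlled_trajectory T u x v &
     [/\ x 0 = x0, v 0 = 0 & (x T, v T) = xv]]].

(* 0_{x0} is interior to S for the topology of TG, read in the chart of TG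
   induced by the chart x0 of G (the product topology on G * 'rV_n is not
   the topology of TG). *)
Definition zero_in_interior (x0 : G) (S : set (G * 'rV[R]_n)) : Prop :=
  \forall aw \near ((chart x0 x0, 0) : 'rV[R]_n * 'rV[R]_n),
    S (chart_inv x0 aw.1, tlift x0 (chart_inv x0 aw.1) aw.2).

Definition convex_hull (U : set 'rV[R]_m) : set 'rV[R]_m :=
  [set u | exists (k : nat) (c : 'I_k -> R) (w : 'I_k -> 'rV[R]_m),
     [/\ forall i, 0 <= c i, \sum_i c i = 1, forall i, U (w i)
       & u = \sum_i c i *: w i]].

Definition proper_control_set (U : set 'rV[R]_m) : Prop :=
  interior (convex_hull U) 0.

Definition stlc (U : set 'rV[R]_m) : Prop :=
  forall x0 : G, exists2 t0, 0 < t0 &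
    forall t, 0 < t -> t <= t0 -> zero_in_interior x0 (reachable U x0 t).

End ControlSystem.

Section OptimalControl.
Context {R : realType} {n m : nat} {G : lieGroupType R n}.
Variables (g : riemannian_metric G) (E : 'I_m -> 'rV[R]_n).
Variable L : G -> 'rV[R]_n -> 'rV[R]_m -> R.

Definition smooth_cost : Prop := forall p,
  smooth [set q : 'rV[R]_n * 'rV[R]_n * 'rV[R]_m | chart_im p q.1.1]
    (fun q => L (chart_inv p q.1.1) q.1.2 q.2 : R^o).

Definition drift_ctrl (y : 'rV[R]_n) (u : 'rV[R]_m) : 'rV[R]_n :=
  ctrl E u + sharp g (ad_dual (G := G) y (flat g y)).

(* Points (x, y, mu, xi), points (x, y, mu, xi, u), fibres (z, w, vmu, vxi)
   of the prolongation T, and fibres (z, w, vmu, vxi, vu) of T~. *)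
Definition phase : Type := (G * 'rV[R]_n * 'cV[R]_n * 'cV[R]_n)%type.
Definition cphase : Type := (phase * 'rV[R]_m)%type.
Definition fibre : Type :=
  ('rV[R]_n * 'rV[R]_n * 'cV[R]_n * 'cV[R]_n)%type.
Definition cfibre : Type := (fibre * 'rV[R]_m)%type.

Definition pr1 (a : cphase) : phase := a.1.

Definition Hamiltonian (a : cphase) : R :=
  let: (x, y, mu, xi, u) := a in
  pairing mu y + pairing xi (drift_ctrl y u) - L x y u.

(* dH_a on tangent vectors (v, w, vmu, vxi, vu), v : T_x G. *)
Definition dHamiltonian (a : cphase)
    (q : 'rV[R]_n * 'rV[R]_n * 'cV[R]_n * 'cV[R]_n * 'rV[R]_m) : R :=
  let: (x, y, mu, xi, u) := a in
  'd (fun b : 'rV[R]_n * 'rV[R]_n * 'cV[R]_n * 'cV[R]_n * 'rV[R]_m =>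
        let: (c, y', mu', xi', u') := b in
        Hamiltonian (chart_inv x c, y', mu', xi', u') : R^o)
     (chart x x, y, mu, xi, u) q.

Definition anchor (p : phase) (s : fibre) : fibre :=
  let: (x, _, _, _) := p in
  let: (z, w, vmu, vxi) := s in
  (TeL x z, w, vmu, vxi).

Definition canchor (a : cphase) (s : cfibre) : cfibre :=
  (anchor (pr1 a) s.1, s.2).

Definition Omega (p : phase) (s s' : fibre) : R :=
  let: (_, _, mu, _) := p in
  let: (z, w, vmu, vxi) := s in
  let: (z', w', vmu', vxi') := s' in
  pairing vmu' z + pairing vxi' w - (pairing vmu z' + pairing vxi w')
  + pairing mu (ad (G := G) z z').

Definition symplectic_eq (a : cphase) (s : fibre) : Prop :=
  forall s' : cfibre, Omega (pr1 a) s s'.1 = dHamiltonian a (canchor a s').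

Definition crit_domain : set cphase := [set a | exists s, symplectic_eq a s].

(* The solution of the symplectic equation (unique, Omega being
   nondegenerate); junk outside crit_domain. *)
Definition sigmaH (a : cphase) : fibre :=
  xget (0, 0, 0, 0) [set s | symplectic_eq a s].

Definition phase_velocity_within (J : set R) (p : R -> phase) (t : R)
    (s : fibre) : Prop :=
  let: (v, w, vmu, vxi) := s in
  [/\ velocity_within J (fun r => (p r).1.1.1) t v,
      deriv_within J (fun r => (p r).1.1.2) t w,
      deriv_within J (fun r => (p r).1.2) t vmu &
      deriv_within J (fun r => (p r).2) t vxi].

Definition critical_trajectory (J : set R) (a : R -> cphase) : Prop :=
  forall t, J t ->
    crit_domain (a t) /\
    phase_velocity_within J (fun r => pr1 (a r)) t
      (anchor (pr1 (a t)) (sigmaH (a t))).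

Definition dL_dx (x : G) (y : 'rV[R]_n) (u : 'rV[R]_m) : 'cV[R]_n :=
  covec ('d (fun a => L (chart_inv x a) y u : R^o) (chart x x)).

Definition dL_dy (x : G) (y : 'rV[R]_n) (u : 'rV[R]_m) : 'cV[R]_n :=
  covec ('d (fun y' => L x y' u : R^o) y).

(* sum_a (dL / du_a) E_a^*, for Es the covectors E_a^*. *)
Definition dL_du (Es : 'I_m -> 'cV[R]_n) (x : G) (y : 'rV[R]_n)
    (u : 'rV[R]_m) : 'cV[R]_n :=
  \sum_a ('d (fun u' => L x y u' : R^o) u (delta_mx 0 a)) *: Es a.

End OptimalControl.

Section DualBasis.
Context {R : realType} {n : nat}.

(* The columns of the inverse of the matrix whose rows are the E i. *)
Definition dual_basis (E : 'I_n -> 'rV[R]_n) (i : 'I_n) : 'cV[R]_n :=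
  col i (invmx (\matrix_(j < n) E j)).

(* xi^{D_e} = sum_(a < m) xi_a E_a^*, where xi_a = xi (E_a). *)
Definition De_part (m : nat) (hmn : (m <= n)%N) (E : 'I_n -> 'rV[R]_n)
    (xi : 'cV[R]_n) : 'cV[R]_n :=
  \sum_(a < m) pairing xi (E (widen_ord hmn a)) *:
    dual_basis E (widen_ord hmn a).

End DualBasis.

(* Main.v *)
Require Import Defs.
From HB Require Import structures.
From mathcomp Require Import all_boot all_order all_algebra.
From mathcomp Require Import all_classical all_reals all_analysis.
From mathcomp Require Import lra.
Import Order.TTheory GRing.Theory Num.Theory.
Import numFieldNormedType.Exports.
Local Open Scope classical_set_scope.
Local Open Scope ring_scope.

Set Implicit Arguments.
Unset Strict Implicit.
Unset Printing Implicit Defensive.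

(* The Hamiltonian is differentiable in the chart at x, so the symplectic
   equation splits into one scalar identity for each of the test directions
   z', w', v'_mu, v'_xi, v'_u.  Nondegeneracy of the pairing turns them into
   formulas for the components of sigma_H, and the last one into the
   constraint on xi.  The gyroscopic terms of the xi-equation come from
     xi (I^# (ad_y^* I^flat w + ad_w^* I^flat y))
       = (I^flat [y, I^# xi] - ad_(I^# xi)^* I^flat y) (w),
   which needs the bilinearity of the bracket; this in turn rests on the
   differentiability of left-invariant fields, a consequence of the
   smoothness of the group law. *)

(** * Locality of the differential; continuity of linear and bilinear maps *)

Section Differentials.
Context {R : realType}.

(** For small [h] the remainder of [g] at [x] is that of [f], so the first-order expansion of [f]
    also serves for [g]; uniqueness of the differential does the rest. Chart expressions agree only
    on overlaps, so such local statements are used throughout. *)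
Lemma near_eq_is_diff (V W : normedModType R) (f g df : V -> W) (x : V) :
  (\forall z \near x, f z = g z) -> is_diff x f df -> is_diff x g df.
Proof.
move=> fg dfx; have fgx : f x = g x by exact: nbhs_singleton fg.
have dgE : g \o shift x = cst (g x) + 'd f x +o_ 0 id.
  apply/eqaddoP => _/posnumP[e]; near=> h.
  have gh : g (h + x) = f (h + x).
    by near: h; move: fg; rewrite (near_shift 0 x) subr0; apply: filterS => h /= ->.
  rewrite !fctE /= gh -fgx; near: h.
  have fE : f \o shift x = cst (f x) + 'd f x +o_ 0 id.
    by apply: diff_locally; exact: ex_diff.
  by move/eqaddoP : fE => /(_ e%:num); apply.
have fc : continuous ('d f x) by apply: diff_continuous; exact: ex_diff.
have dg : 'd g x = 'd f x :> (V -> W) by exact: diff_unique.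
by split; [apply/diff_locallyP; rewrite dg | rewrite dg; exact: diff_val].
Unshelve. all: by end_near. Qed.

Lemma near_eq_differentiable (V W : normedModType R) (f g : V -> W) (x : V) :
  (\forall z \near x, f z = g z) -> differentiable f x -> differentiable g x.
Proof. by move=> fg /differentiableP/(near_eq_is_diff fg)[]. Qed.

Lemma near_eq_diff (V W : normedModType R) (f g : V -> W) (x : V) :
  (\forall z \near x, f z = g z) -> differentiable f x ->
  'd g x = 'd f x :> (V -> W).
Proof. by move=> fg /differentiableP/(near_eq_is_diff fg)[]. Qed.

Lemma mx_linear_continuous (W : normedModType R) (m n : nat)
  (f : {linear 'M[R]_(m, n) -> W}) : continuous f.
Proof.
have -> : (f : _ -> W) =
    fun M : 'M[R]_(m, n) => \sum_(i < m) \sum_(j < n) M i j *: f (delta_mx i j).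
  apply/funext => M; rewrite {1}(matrix_sum_delta M) linear_sum.
  apply: eq_bigr => i _; rewrite linear_sum; apply: eq_bigr => j _.
  by rewrite linearZ.
apply: continuous_big => [|i _]; first exact: add_continuous.
apply: continuous_big => [|j _]; first exact: add_continuous.
by move=> M; apply/differentiable_continuous/differentiableZl/differentiable_coord.
Qed.

(** Only the first argument is expanded in matrix units; each term is then a coordinate times a
    linear map of the second argument, which is continuous by the previous lemma. *)
Lemma mx_bilinear_continuous (W : normedModType R) (m n p q : nat)
  (f : {bilinear 'M[R]_(m, n) -> 'M[R]_(p, q) -> W}) :
  continuous (fun z => f z.1 z.2).
Proof.
have -> : (fun z => f z.1 z.2) = fun z : 'M[R]_(m, n) * 'M[R]_(p, q) =>
    \sum_(i < m) \sum_(j < n) z.1 i j *: f (delta_mx i j) z.2.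
  apply/funext => -[M N] /=; rewrite {1}(matrix_sum_delta M) linear_sumlz.
  apply: eq_bigr => i _; rewrite linear_sumlz; apply: eq_bigr => j _.
  by rewrite linearZl_LR.
apply: continuous_big => [|i _]; first exact: add_continuous.
apply: continuous_big => [|j _]; first exact: add_continuous.
move=> z.
apply: (@continuousZ _ _ _ (fun z : 'M[R]_(m, n) * 'M[R]_(p, q) => z.1 i j)
  (fun z : 'M[R]_(m, n) * 'M[R]_(p, q) => f (delta_mx i j) z.2)).
  apply: (@continuous_comp _ _ _ fst (fun M : 'M[R]_(m, n) => M i j)).
    exact: cvg_fst.
  exact: coord_continuous.
apply: (@continuous_comp _ _ _ snd (f (delta_mx i j))); first exact: cvg_snd.
exact: mx_linear_continuous.
Qed.

End Differentials.

(** * Consequences of smoothness and a local chain rule *)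

Section Smooth.
Context {R : realType} {V W : normedModType R}.
Variables (U : set V) (f : V -> W).
Hypothesis f_smooth : smooth U f.

Lemma smooth_differentiable x : U x -> differentiable f x.
Proof. by have [+ _] := f_smooth 1; apply. Qed.

Lemma smooth_diff_differentiable v x :
  U x -> differentiable (fun z => 'd f z v) x.
Proof. by have [_ /(_ v)[+ _]] := f_smooth 2; apply. Qed.

End Smooth.

Lemma is_diff_pairr (R : realType) (V W : normedModType R) (a : V) (b : W) :
  is_diff b (fun b => (a, b)) (fun w => (0, w)).
Proof. by apply: (is_diff_pair (is_diff_cst a b) (is_diff_id b)). Qed.

Lemma near_eq_diff_comp (R : realType) (U V W : normedModType R)
  (f : U -> V) (g : V -> W) (h : U -> W) (x v : U) (y : V) :
  f x = y -> differentiable f x -> differentiable g y ->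
  (\forall z \near x, g (f z) = h z) -> 'd g y ('d f x v) = 'd h x v.
Proof.
move=> <- df dg gfh.
have E := etrans (near_eq_diff gfh (differentiable_comp df dg)) (diff_comp df dg).
exact/esym/(congr1 (fun F : U -> W => F v) E).
Qed.

Lemma diffP_at (R : realType) (V W : normedModType R) (k : R) (f g : V -> W)
  (x v : V) : differentiable f x -> differentiable g x ->
  'd (k *: f + g) x v = k *: 'd f x v + 'd g x v.
Proof.
move=> df dg; have E := diffD (differentiableZ k df) dg.
apply: (etrans (congr1 (fun F : V -> W => F v) E)).
exact: (congr1 (fun F : V -> W => F v + 'd g x v) (diffZ k df)).
Qed.

(** * Left-invariant fields in charts and bilinearity of the bracket *)

Section LieAlgebra.
Context {R : realType} {n : nat} {G : lieGroupType R n}.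
Implicit Types (p q x y : G) (a b v w z : 'rV[R]_n).

Lemma chart_inv_dom p a : chart_im p a -> chart_dom p (chart_inv p a).
Proof. by case=> x px <-; rewrite chartK. Qed.

Lemma chart_invK p a : chart_im p a -> chart p (chart_inv p a) = a.
Proof. by case=> x px <-; rewrite chartK. Qed.

Lemma chart_im_chart p x : chart_dom p x -> chart_im p (chart p x).
Proof. by exists x. Qed.

Lemma near_chart_im p x : chart_dom p x ->
  \forall a \near chart p x, chart_im p a.
Proof.
move=> px; apply: open_nbhs_nbhs; split; first exact: chart_im_open.
exact: chart_im_chart.
Qed.

Lemma near_chart_dom_mul p q x y : chart_dom p y -> chart_dom q (x * y)%g ->
  \forall b \near chart p y, chart_dom q (x * chart_inv p b)%g.
Proof.
move=> py qxy.
have inv_cont : {for chart p y, continuous (chart_inv p)}.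
  by apply: chart_inv_continuous; exact: chart_im_chart.
have mul_cont : {for chart p y, continuous (fun b => (x * chart_inv p b)%g)}.
  apply: (@continuous_comp _ _ _ (fun b => (x, chart_inv p b))
    (fun xy : G * G => (xy.1 * xy.2)%g)); last exact: lie_mul_continuous.
  apply: (@cvg_pair _ _ _ (nbhs (chart p y)) _ _ _ _ _ (fun=> x)) => //.
  exact: cvg_cst.
apply: (mul_cont (chart_dom q)) => /=; rewrite chartK//.
by apply: open_nbhs_nbhs; split => //; exact: chart_dom_open.
Qed.

Lemma mul_chart_differentiable p q r a b :
  chart_im p a -> chart_im q b ->
  chart_dom r (chart_inv p a * chart_inv q b)%g ->
  differentiable (fun ab : 'rV[R]_n * 'rV[R]_n =>
    chart r (chart_inv p ab.1 * chart_inv q ab.2)%g) (a, b).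
Proof.
by move=> pa qb rab; apply: (smooth_differentiable (@lie_mul_smooth R n G p q r)).
Qed.

(** [TeL x] is computed in the chart at [x], which varies with [x]. The chain rule removes this
    chart and leaves a partial differential of the group law in the fixed chart [q], where the
    dependence on [x] is visibly smooth. *)
Lemma tcoord_TeL q x w : chart_dom q x ->
  tcoord q x (TeL x w) =
  'd (fun ab : 'rV[R]_n * 'rV[R]_n =>
        chart q (chart_inv q ab.1 * chart_inv 1%g ab.2)%g)
     (chart q x, chart (1%g : G) 1%g) (0, w).
Proof.
move=> qx; set c := chart (1%g : G) 1%g.
have c1 : chart_inv 1%g c = 1%g :> G by rewrite chartK//; exact: chart_dom_center.
have cim : chart_im (1%g : G) c by apply/chart_im_chart/chart_dom_center.
have xx := chart_dom_center x.
pose mulx p b := chart p (x * chart_inv 1%g b)%g.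
(* Freezing the first factor at [x] turns the multiplication into left translation; this is needed
   both for [p = x] and for [p = q]. *)
have mulx_diff p : chart_dom p x -> is_diff c (mulx p)
    (fun w => 'd (fun ab : 'rV[R]_n * 'rV[R]_n =>
        chart p (chart_inv p ab.1 * chart_inv 1%g ab.2)%g)
     (chart p x, c) (0, w)).
  move=> px.
  have dM : differentiable (fun ab : 'rV[R]_n * 'rV[R]_n =>
        chart p (chart_inv p ab.1 * chart_inv 1%g ab.2)%g) (chart p x, c).
    apply: mul_chart_differentiable => //; first exact: chart_im_chart.
    by rewrite chartK// c1 mulg1.
  have /= := is_diff_comp (is_diff_pairr (chart p x) c) (differentiableP dM).
  have -> // : (fun ab : 'rV[R]_n * 'rV[R]_n =>
     chart p (chart_inv p ab.1 * chart_inv 1%g ab.2)%g) \o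
       (fun b => (chart p x, b)) = mulx p.
  by apply/funext => b; rewrite /mulx /= chartK.
have mulxc p : mulx p c = chart p x by rewrite /mulx c1 mulg1.
rewrite /tcoord /TeL /tangent_map mulg1 -/c -/(mulx x).
have dT : differentiable (fun a => chart q (chart_inv x a)) (chart x x).
  apply: (smooth_differentiable (@chart_transition R n G x q)).
  by split; [exact: chart_im_chart | rewrite chartK].
have dx : differentiable (mulx x) c by case: (mulx_diff _ xx).
have [_ dqE] := mulx_diff _ qx.
apply: etrans (congr1 (fun F : 'rV[R]_n -> 'rV[R]_n => F w) dqE).
(* The charts at [x] cancel only while [x * chart_inv 1 b] stays in [chart_dom x], which holds for
   [b] near [c]. *)
apply: near_eq_diff_comp => //.
near=> b; rewrite /mulx /= chartK//; near: b.
apply: near_chart_dom_mul; first exact: chart_dom_center.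
by rewrite mulg1.
Unshelve. all: by end_near. Qed.

(** By [tcoord_TeL] the field is, near [chart q x], the map sending [a] to ['d M (a, c) (0, w)],
    with [M] the group law in coordinates. The order-two part of the smoothness of [M] makes this
    differentiable. *)
Lemma left_field_differentiable q x w : chart_dom q x ->
  differentiable (field_coord q (left_field w)) (chart q x).
Proof.
move=> qx; set c := chart (1%g : G) 1%g.
have c1 : chart_inv 1%g c = 1%g :> G by rewrite chartK//; exact: chart_dom_center.
pose M (ab : 'rV[R]_n * 'rV[R]_n) :=
  chart q (chart_inv q ab.1 * chart_inv (1%g : G) ab.2)%g.
apply: (@near_eq_differentiable _ _ _ (fun a => 'd M (a, c) (0, w))).
  near=> a.
  have qa : chart_im q a by near: a; exact: near_chart_im.
  by rewrite /field_coord /left_field tcoord_TeL ?chart_invK//; exact: chart_inv_dom.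
apply: (@differentiable_comp _ _ _ _ (fun a => (a, c)) (fun ab => 'd M ab (0, w))).
  exact: differentiable_pair.
apply: (smooth_diff_differentiable (@lie_mul_smooth R n G q 1%g q)).
split => /=; [exact: chart_im_chart | exact/chart_im_chart/chart_dom_center |].
by rewrite c1 mulg1 chartK.
Unshelve. all: by end_near. Qed.

Lemma TeL_linear x : linear (TeL x).
Proof. exact: linearP. Qed.

Lemma tcoord_linear p x : linear (tcoord p x).
Proof. exact: linearP. Qed.

Lemma field_coord_left_fieldP q k w w' :
  field_coord q (left_field (k *: w + w')) =
  k *: field_coord (G := G) q (left_field w) + field_coord q (left_field w').
Proof.
by apply/funext => a; rewrite /field_coord /left_field TeL_linear tcoord_linear.
Qed.

Lemma ad_antisym z w : ad (G := G) z w = - ad (G := G) w z.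
Proof. by rewrite /ad /field_bracket opprB. Qed.

(** In the first term of the bracket the field depends linearly on [w], and its differentiability
    lets the differential pass through the sum ([E1]). In the second term [w] is only the direction
    of differentiation ([E2]). *)
Lemma ad_linearr z : linear (ad (G := G) z).
Proof.
move=> k w w'; pose e : G := 1%g; pose F u := field_coord e (left_field u).
have dF u : differentiable (F u) (chart e e).
  exact/left_field_differentiable/chart_dom_center.
have E1 : 'd (F (k *: w + w')) (chart e e) (left_field z e) =
    k *: 'd (F w) (chart e e) (left_field z e) +
    'd (F w') (chart e e) (left_field z e).
  rewrite {1}/F field_coord_left_fieldP.
  exact (diffP_at k (left_field z e) (dF w) (dF w')).
have E2 : 'd (F z) (chart e e) (left_field (k *: w + w') e) =
    k *: 'd (F z) (chart e e) (left_field w e) +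
    'd (F z) (chart e e) (left_field w' e).
  by rewrite /left_field TeL_linear; exact: linearP.
apply: etrans (congr2 (fun a b => a - b) E1 E2) _.
by rewrite opprD addrACA -scalerBr.
Qed.

Lemma ad_linearl z : linear (fun w => ad (G := G) w z).
Proof.
move=> k w w'; rewrite ad_antisym ad_linearr opprD -scalerN.
by rewrite -!ad_antisym.
Qed.

End LieAlgebra.

(** * Differentials of linear maps, bilinear maps and projections *)

Section MatrixMaps.
Context {R : realType}.

(** The linear structure is packed from the bare hypothesis, so that the lemma applies to plain
    functions such as [ctrl E]. *)
Lemma is_diff_mx_linear (W : normedModType R) (m n : nat)
    (f : 'M[R]_(m, n) -> W) (x : 'M[R]_(m, n)) :
  linear f -> is_diff x f f.
Proof.
move=> f_lin.
pose fM := GRing.isLinear.Build _ _ _ _ _ f_lin.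
pose fL : {linear 'M[R]_(m, n) -> W} := HB.pack f fM.
have fc : continuous fL by exact: mx_linear_continuous.
split; [exact: (linear_differentiable (f := fL)) | exact: (diff_lin (f := fL))].
Qed.

Lemma is_diff_mx_bilinear (W : normedModType R) (m n p q : nat)
    (f : 'M[R]_(m, n) -> 'M[R]_(p, q) -> W) (z : 'M[R]_(m, n) * 'M[R]_(p, q)) :
  (forall y, linear (f^~ y)) -> (forall x, linear (f x)) ->
  is_diff z (fun z => f z.1 z.2) (fun h => f z.1 h.2 + f h.1 z.2).
Proof.
move=> f_linl f_linr.
have f_bilin : bilinear_for
    (GRing.Scale.Law.clone _ _ *:%R _) (GRing.Scale.Law.clone _ _ *:%R _) f.
  by split.
pose fM := bilinear_isBilinear.Build R _ _ _ _ _ f f_bilin.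
pose fB : {bilinear 'M[R]_(m, n) -> 'M[R]_(p, q) -> W} := HB.pack f fM.
have fc : continuous (fun z => fB z.1 z.2) by exact: mx_bilinear_continuous.
split.
- exact: (differentiable_bilin (f := fB)).
- exact: (diff_bilin (f := fB)).
Qed.

Lemma is_diff_fst (U V W : normedModType R) (f df : U -> V * W) (x : U) :
  is_diff x f df -> is_diff x (fun z => (f z).1) (fun h => (df h).1).
Proof.
move=> dfx.
have fstc : continuous (@fst V W) by move=> z; exact: cvg_fst.
have d1 : is_diff (f x) (@fst V W) (@fst V W).
  by split; [exact: linear_differentiable | exact: diff_lin].
exact: (is_diff_comp dfx d1).
Qed.

Lemma is_diff_snd (U V W : normedModType R) (f df : U -> V * W) (x : U) :
  is_diff x f df -> is_diff x (fun z => (f z).2) (fun h => (df h).2).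
Proof.
move=> dfx.
have sndc : continuous (@snd V W) by move=> z; exact: cvg_snd.
have d2 : is_diff (f x) (@snd V W) (@snd V W).
  by split; [exact: linear_differentiable | exact: diff_lin].
exact: (is_diff_comp dfx d2).
Qed.

End MatrixMaps.

(** * The pairing of covectors and vectors *)

Section Covectors.
Context {R : realType} {n : nat}.
Implicit Types (alpha beta : 'cV[R]_n) (v w : 'rV[R]_n).

Lemma pairing_linearl v : linear (fun alpha => pairing alpha v : R^o).
Proof. by move=> k alpha beta; rewrite /pairing mulmxDr -scalemxAr !mxE. Qed.

Lemma pairing_linearr alpha : linear (pairing alpha : _ -> R^o).
Proof. by move=> k v w; rewrite /pairing mulmxDl -scalemxAl !mxE. Qed.

Lemma pairing0l v : pairing 0 v = 0.
Proof. by rewrite /pairing mulmx0 mxE. Qed.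

Lemma pairing0r alpha : pairing alpha 0 = 0.
Proof. by rewrite /pairing mul0mx mxE. Qed.

Lemma pairingDl alpha beta v :
  pairing (alpha + beta) v = pairing alpha v + pairing beta v.
Proof. by rewrite /pairing mulmxDr mxE. Qed.

Lemma pairingNl alpha v : pairing (- alpha) v = - pairing alpha v.
Proof. by rewrite /pairing mulmxN mxE. Qed.

Lemma pairingDr alpha v w :
  pairing alpha (v + w) = pairing alpha v + pairing alpha w.
Proof. by rewrite /pairing mulmxDl mxE. Qed.

Lemma pairingNr alpha v : pairing alpha (- v) = - pairing alpha v.
Proof. by rewrite /pairing mulNmx mxE. Qed.

Lemma pairing_covec (f : 'rV[R]_n -> R) v :
  linear (f : _ -> R^o) -> pairing (covec f) v = f v.
Proof.
move=> f_lin; pose fM := GRing.isLinear.Build _ _ _ _ _ f_lin.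
pose fL : {linear 'rV[R]_n -> R^o} := HB.pack (f : _ -> R^o) fM.
rewrite {2}(row_sum_delta v) -[f]/(fL : _ -> _) linear_sum /pairing mxE.
by apply: eq_bigr => k _; rewrite linearZ mxE.
Qed.

Lemma pairing_injl alpha beta :
  (forall v, pairing alpha v = pairing beta v) -> alpha = beta.
Proof.
move=> E; apply/colP => k; have := E (delta_mx 0 k).
by rewrite /pairing -!rowE !mxE.
Qed.

Lemma pairing_injr v w :
  (forall alpha, pairing alpha v = pairing alpha w) -> v = w.
Proof.
move=> E; apply/rowP => k; have := E (delta_mx k 0).
by rewrite /pairing -!colE !mxE.
Qed.

Lemma covec_linear (V : lmodType R) (F : V -> 'rV[R]_n -> R) :
  (forall v, linear (fun z => F z v : R^o)) -> linear (fun z => covec (F z)).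
Proof. by move=> F_lin k z z'; apply/colP => i; rewrite !mxE F_lin. Qed.

End Covectors.

(** * Musical isomorphisms and the gyroscopic term *)

Section Inertia.
Context {R : realType} {n m : nat} {G : lieGroupType R n}.
Variables (g : riemannian_metric G) (E : 'I_m -> 'rV[R]_n).
Implicit Types (y z w : 'rV[R]_n) (mu nu xi : 'cV[R]_n).

Lemma inertia_linearl w : linear (fun y => inertia g y w : R^o).
Proof. by move=> k y z; exact: metric_linear. Qed.

Lemma inertia_sym y w : inertia g y w = inertia g w y.
Proof. exact: Defs.metric_sym. Qed.

Lemma inertia_linearr y : linear (inertia g y : _ -> R^o).
Proof. by move=> k w z; rewrite !(inertia_sym y) inertia_linearl. Qed.

Lemma flat_linear : linear (flat g).
Proof. exact/covec_linear/inertia_linearl. Qed.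

Lemma pairing_flat y w : pairing (flat g y) w = inertia g y w.
Proof. exact/pairing_covec/inertia_linearr. Qed.

Lemma ad_dual_linearl mu : linear (fun z => ad_dual (G := G) z mu).
Proof.
apply: (covec_linear (F := fun z w => pairing mu (ad (G := G) z w))) => w k z z'.
by rewrite ad_linearl pairing_linearr.
Qed.

Lemma ad_dual_linearr z : linear (ad_dual (G := G) z).
Proof.
apply: (covec_linear (F := fun mu w => pairing mu (ad (G := G) z w))) => w.
exact: pairing_linearl.
Qed.

Lemma pairing_ad_dual z mu w :
  pairing (ad_dual (G := G) z mu) w = pairing mu (ad (G := G) z w).
Proof. by apply: pairing_covec => k v v'; rewrite ad_linearr pairing_linearr. Qed.

Lemma sharp_linear : linear (sharp g).
Proof. by move=> k mu nu; rewrite /sharp mulmxDr -scalemxAr !linearP. Qed.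

(** The inverse of the symmetric inertia matrix is symmetric, and a 1 by 1 matrix equals its
    transpose. *)
Lemma pairing_sharp xi nu : pairing xi (sharp g nu) = pairing nu (sharp g xi).
Proof.
have M_sym : (inertia_mx g)^T = inertia_mx g.
  by apply/matrixP => i j; rewrite !mxE inertia_sym.
have tr11 (A : 'M[R]_1) : A 0 0 = A^T 0 0 by rewrite mxE.
by rewrite /pairing /sharp tr11 !trmx_mul !trmxK trmx_inv M_sym mulmxA.
Qed.

(** Polarisation of the quadratic drift, which is [gyro y y]; the product rule then gives its
    derivative along [w] as [gyro y w + gyro w y]. *)
Definition gyro y z : 'rV[R]_n := sharp g (ad_dual (G := G) y (flat g z)).

Lemma gyro_linearl z : linear (gyro^~ z).
Proof. by move=> k y w; rewrite /gyro ad_dual_linearl sharp_linear. Qed.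

Lemma gyro_linearr y : linear (gyro y).
Proof. by move=> k z w; rewrite /gyro flat_linear ad_dual_linearr sharp_linear. Qed.

Lemma pairing_gyro xi y z :
  pairing xi (gyro y z) = inertia g z (ad (G := G) y (sharp g xi)).
Proof. by rewrite /gyro pairing_sharp pairing_ad_dual pairing_flat. Qed.

(** With [s] for [sharp g xi], [pairing_gyro] turns the left side into I(w, [y, s]) + I(y, [w, s]).
    Symmetry of I handles the first summand, antisymmetry of the bracket the second. *)
Lemma pairing_gyroD xi y w :
  pairing xi (gyro y w + gyro w y) =
  pairing (flat g (ad (G := G) y (sharp g xi))
           - ad_dual (G := G) (sharp g xi) (flat g y)) w.
Proof.
(* Rewriting would try to unify gyro y w with gyro w y by unfolding ad, which
   does not terminate in practice; hence the explicit chain of equalities. *)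
apply: etrans (pairingDr _ _ _) _; apply/esym.
apply: etrans (pairingDl _ _ _) _; apply: congr2.
  apply: etrans (pairing_flat _ _) _; apply: etrans (inertia_sym _ _) _.
  exact/esym/pairing_gyro.
apply: etrans (pairingNl _ _) _; apply: etrans (congr1 -%R (pairing_ad_dual _ _ _)) _.
apply: etrans (esym (pairingNr _ _)) _; apply: etrans (pairing_flat _ _) _.
apply: etrans (congr1 _ (esym (ad_antisym _ _))) _; exact/esym/pairing_gyro.
Qed.

Lemma ctrl_linear : linear (ctrl E).
Proof.
move=> k u v; rewrite /ctrl scaler_sumr -big_split; apply: eq_bigr => a _ /=.
by rewrite !mxE scalerDl scalerA.
Qed.

Lemma ctrl_delta a : ctrl E (delta_mx 0 a) = E a.
Proof.
rewrite /ctrl (bigD1 a)//= mxE !eqxx scale1r big1 ?addr0// => b /negPf ba.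
by rewrite mxE ba andbF scale0r.
Qed.

End Inertia.

(** * Partial differentials and separation of the test directions *)

Lemma diff_partial (R : realType) (U V W : normedModType R)
  (f df : U -> V) (g : V -> W) (x v : U) :
  is_diff x f df -> differentiable g (f x) ->
  'd g (f x) (df v) = 'd (fun z => g (f z)) x v.
Proof.
move=> [dfx <-] dg.
by apply: (near_eq_diff_comp (f := f)) => //; exact: nearW.
Qed.

Lemma linear_map0 (R : pzRingType) (U V : lmodType R) (f : U -> V) :
  linear f -> f 0 = 0.
Proof.
move=> f_lin; have := f_lin (-1) 0 0.
by rewrite scaler0 addr0 scaleN1r addNr.
Qed.

(** Each conclusion comes from letting all test vectors but one vanish. In the application [alpha],
    [beta], [gamma], [delta] are the covectors of the x-derivative of the cost, the gyroscopic
    terms, the coadjoint term and the y-derivative of the cost; [c] and [l] carry the dependence on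
    the control direction. *)
Lemma pairing_form_eq (R : realType) (n m : nat) (y z w v : 'rV[R]_n)
  (mu vmu vxi alpha beta gamma delta : 'cV[R]_n) (c l : 'rV[R]_m -> R) :
  c 0 = 0 -> l 0 = 0 ->
  (forall z' w' (vmu' vxi' : 'cV[R]_n) vu',
    pairing vmu' z + pairing vxi' w - (pairing vmu z' + pairing vxi w')
      + pairing gamma z' =
    pairing mu w' + pairing vmu' y
    + (c vu' + pairing beta w' + pairing vxi' v)
    - (pairing alpha z' + pairing delta w' + l vu')) ->
  [/\ z = y, w = v, vmu = alpha + gamma, vxi = - mu + delta - beta & c =1 l].
Proof.
move=> c0 l0 H; split.
- apply: pairing_injr => a; have := H 0 0 a 0 0.
  by rewrite !(pairing0l, pairing0r) c0 l0 !(addr0, add0r, subr0).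
- apply: pairing_injr => a; have := H 0 0 0 a 0.
  by rewrite !(pairing0l, pairing0r) c0 l0 !(addr0, add0r, subr0).
- apply: pairing_injl => a; have := H a 0 0 0 0.
  rewrite pairingDl !(pairing0l, pairing0r) c0 l0 !(addr0, add0r, subr0) => E.
  by lra.
- apply: pairing_injl => a; have := H 0 a 0 0 0.
  rewrite !(pairingDl, pairingNl) !(pairing0l, pairing0r) c0 l0.
  rewrite !(addr0, add0r, subr0) => E.
  by lra.
- move=> vu; have := H 0 0 0 0 vu.
  by rewrite !(pairing0l, pairing0r) !(addr0, add0r, subr0) => E; lra.
Qed.

(** * The differential of the Hamiltonian and the symplectic equation *)

Section Critical.
Context {R : realType} {n m : nat} {G : lieGroupType R n}.
Variables (g : riemannian_metric G) (E : 'I_m -> 'rV[R]_n).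
Variable L : G -> 'rV[R]_n -> 'rV[R]_m -> R.
Hypothesis L_smooth : smooth_cost L.
Implicit Types (x : G) (y z v w : 'rV[R]_n) (mu xi : 'cV[R]_n) (u : 'rV[R]_m).

Lemma is_diff_cost x y u :
  is_diff (chart x x, y, u)
    (fun q : 'rV[R]_n * 'rV[R]_n * 'rV[R]_m =>
       L (chart_inv x q.1.1) q.1.2 q.2 : R^o)
    (fun h => pairing (dL_dx L x y u) h.1.1 + pairing (dL_dy L x y u) h.1.2
              + 'd (fun u' => L x y u' : R^o) u h.2).
Proof.
set c := chart x x; set Lc := (X in is_diff _ X _).
have dL : differentiable Lc (c, y, u).
  by apply: (smooth_differentiable (L_smooth x)); exact/chart_im_chart/chart_dom_center.
have cK : chart_inv x c = x by rewrite chartK//; exact: chart_dom_center.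
split => //; apply/funext => -[[v w] h] /=.
(* Each summand is tangent to an inclusion of one factor, so [diff_partial] identifies its
   contribution with a partial differential; [cK] returns from coordinates to [x] for the last
   two. *)
have -> : (v, w, h) = (v, 0, 0) + (0, w, 0) + (0, 0, h) :> 'rV_n * 'rV_n * 'rV_m.
  by congr (_, _, _); rewrite /= ?addr0 ?add0r.
rewrite (linearD ('d Lc (c, y, u))) (linearD ('d Lc (c, y, u))).
congr (_ + _ + _).
- apply/esym; rewrite /dL_dx pairing_covec; last exact: linearP.
  apply/esym.
  have dc : is_diff c (fun a => (a, y, u)) (fun a => (a, 0, 0)).
    exact: is_diff_pair (is_diff_pair (is_diff_id c) (is_diff_cst y c)) (is_diff_cst u c).
  exact: (@diff_partial _ _ _ _ (fun a => (a, y, u)) _ Lc c v dc dL).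
- apply/esym; rewrite /dL_dy pairing_covec; last exact: linearP.
  apply/esym.
  have dy : is_diff y (fun y => (c, y, u)) (fun y => (0, y, 0)).
    exact: is_diff_pair (is_diff_pair (is_diff_cst c y) (is_diff_id y)) (is_diff_cst u y).
  apply: (etrans (@diff_partial _ _ _ _ (fun y => (c, y, u)) _ Lc y w dy dL)).
  by rewrite /Lc /= cK.
- have du : is_diff u (fun u => (c, y, u)) (fun u => (0, 0, u)).
    exact: is_diff_pair (is_diff_cst (c, y) u) (is_diff_id u).
  apply: (etrans (@diff_partial _ _ _ _ (fun u => (c, y, u)) _ Lc u h du dL)).
  by rewrite /Lc /= cK.
Qed.



Lemma dHamiltonianE x y mu xi u v w (vmu vxi : 'cV[R]_n) (vu : 'rV[R]_m) :
  dHamiltonian g E L (x, y, mu, xi, u) (v, w, vmu, vxi, vu) =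
    pairing mu w + pairing vmu y
    + (pairing xi (ctrl E vu + (gyro g y w + gyro g w y))
       + pairing vxi (drift_ctrl g E y u))
    - (pairing (dL_dx L x y u) v + pairing (dL_dy L x y u) w
       + 'd (fun u' => L x y u' : R^o) u vu).
Proof.
rewrite /dHamiltonian; set c := chart x x.
pose T := ('rV[R]_n * 'rV[R]_n * 'cV[R]_n * 'cV[R]_n * 'rV[R]_m)%type.
set H := (X in 'd X _); set b : T := (c, y, mu, xi, u).
have dy : is_diff b (fun q : T => q.1.1.1.2) (fun q : T => q.1.1.1.2).
  exact: is_diff_snd (is_diff_fst (is_diff_fst (is_diff_fst (is_diff_id b)))).
have dc : is_diff b (fun q : T => q.1.1.1.1) (fun q : T => q.1.1.1.1).
  exact: is_diff_fst (is_diff_fst (is_diff_fst (is_diff_fst (is_diff_id b)))).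
have dmu : is_diff b (fun q : T => q.1.1.2) (fun q : T => q.1.1.2).
  exact: is_diff_snd (is_diff_fst (is_diff_fst (is_diff_id b))).
have dxi : is_diff b (fun q : T => q.1.2) (fun q : T => q.1.2).
  exact: is_diff_snd (is_diff_fst (is_diff_id b)).
have du : is_diff b (fun q : T => q.2) (fun q : T => q.2).
  exact: is_diff_snd (is_diff_id b).
have dpair := is_diff_mx_bilinear (f := fun alpha v => pairing alpha v : R^o) _
  pairing_linearl pairing_linearr.
have dmuy := is_diff_comp (is_diff_pair dmu dy) (dpair (mu, y)).
have dgyro := is_diff_comp (is_diff_pair dy dy)
  (is_diff_mx_bilinear (y, y) (gyro_linearl g) (gyro_linearr g)).
have dctrl := is_diff_comp du (is_diff_mx_linear u (ctrl_linear E)).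
have ddrift := is_diffD dctrl dgyro.
have dxidrift := is_diff_comp (is_diff_pair dxi ddrift) (dpair (xi, drift_ctrl g E y u)).
have dcost := is_diff_comp (is_diff_pair (is_diff_pair dc dy) du) (is_diff_cost x y u).
have dH := is_diffB (is_diffD dmuy dxidrift) dcost.
have [_ dHE] := dH.
(* [H'] is the Hamiltonian assembled from projections, whereas [H] destructs its argument; they
   agree on explicit tuples. *)
set H' := (X in 'd X _) in dHE.
have HE : H' = H by apply/funext => -[[[[c' y'] mu'] xi'] u'].
rewrite HE in dHE.
exact: (congr1 (fun F : T -> R^o => F (v, w, vmu, vxi, vu)) dHE).
Qed.

Lemma symplectic_eqP x y mu xi u z w (vmu vxi : 'cV[R]_n) :
  symplectic_eq g E L (x, y, mu, xi, u) (z, w, vmu, vxi) ->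
  [/\ z = y, w = drift_ctrl g E y u,
      vmu = TeL_dual x (dL_dx L x y u) + ad_dual (G := G) y mu,
      vxi = - mu + dL_dy L x y u - flat g (ad (G := G) y (sharp g xi))
            + ad_dual (G := G) (sharp g xi) (flat g y) &
      forall vu, pairing xi (ctrl E vu) = 'd (fun u' => L x y u' : R^o) u vu].
Proof.
move=> seq.
have TeL_pairing z' : pairing (dL_dx L x y u) (TeL x z') =
    pairing (TeL_dual x (dL_dx L x y u)) z'.
  by apply/esym/pairing_covec => k v v'; rewrite TeL_linear pairing_linearr.
have ctrl0 : pairing xi (ctrl E 0) = 0.
  by rewrite (linear_map0 (ctrl_linear E)) pairing0r.
have dL0 : 'd (fun u' => L x y u' : R^o) u 0 = 0 by exact: linear0.
set beta := flat g (ad (G := G) y (sharp g xi)) - ad_dual (G := G) (sharp g xi) (flat g y).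
(* The symplectic form contributes mu([z, z']), so the coadjoint term first appears with [z]; it
   becomes [y] once [zy] is known. *)
have [zy -> -> -> cE] : [/\ z = y, w = drift_ctrl g E y u,
    vmu = TeL_dual x (dL_dx L x y u) + ad_dual (G := G) z mu,
    vxi = - mu + dL_dy L x y u - beta &
    (fun vu => pairing xi (ctrl E vu)) =1
    (fun vu => 'd (fun u' => L x y u' : R^o) u vu)].
  apply: pairing_form_eq => // z' w' vmu' vxi' vu'.
  rewrite -TeL_pairing pairing_ad_dual -pairing_gyroD -pairingDr -dHamiltonianE.
  exact: (seq ((z', w', vmu', vxi'), vu')).
by split; rewrite ?zy// /beta opprB addrA addrAC.
Qed.

End Critical.

Theorem proposition1 (R : realType) (n m : nat) (hmn : (m <= n)%N)
  (G : lieGroupType R n)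
  (g : riemannian_metric G) (g_inv : left_invariant g)
  (E : 'I_n -> 'rV[R]_n)
  (E_basis : row_free (\matrix_(i < n) E i))
  (E_orth : forall j : 'I_n, (m <= j)%N ->
     forall u : 'rV[R]_m,
       inertia g (E j) (ctrl (fun a : 'I_m => E (widen_ord hmn a)) u) = 0)
  (G_stlc : forall U : set 'rV[R]_m, proper_control_set U ->
     stlc g (fun a : 'I_m => E (widen_ord hmn a)) U)
  (L : G -> 'rV[R]_n -> 'rV[R]_m -> R) (L_smooth : smooth_cost L)
  (J : interval R)
  (x : R -> G) (y : R -> 'rV[R]_n) (mu xi : R -> 'cV[R]_n)
  (u : R -> 'rV[R]_m)
  (crit : critical_trajectory g (fun a : 'I_m => E (widen_ord hmn a)) L
     [set` J] (fun t => (x t, y t, mu t, xi t, u t))) :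
  forall t : R, t \in J ->
    [/\ velocity_within [set` J] x t (TeL (x t) (y t)),
        deriv_within [set` J] y t
          (ctrl (fun a : 'I_m => E (widen_ord hmn a)) (u t)
           + sharp g (ad_dual (G := G) (y t) (flat g (y t)))),
        deriv_within [set` J] mu t
          (TeL_dual (x t) (dL_dx L (x t) (y t) (u t))
           + ad_dual (G := G) (y t) (mu t)),
        deriv_within [set` J] xi t
          (- mu t + dL_dy L (x t) (y t) (u t)
           - flat g (ad (G := G) (y t) (sharp g (xi t)))
           + ad_dual (G := G) (sharp g (xi t)) (flat g (y t))) &
        0 = De_part hmn E (xi t)
            - dL_du L (fun a : 'I_m => dual_basis E (widen_ord hmn a))
                (x t) (y t) (u t)].
Proof.
(* Membership in [crit_domain] ensures that [xget] returns an actual solution and not its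
   default. *)
move=> t Jt; have [/(xgetPex (0, 0, 0, 0)) + +] := crit t Jt.
rewrite /sigmaH; case: (xget _ _) => [[[z w] nmu] nxi].
move=> /(symplectic_eqP L_smooth)[-> -> -> -> constraint] [vx vy vmu vxi].
apply: And5 vx vy vmu vxi _; rewrite /De_part /dL_du.
apply/esym/eqP; rewrite subr_eq0; apply/eqP.
(* Both sums run over the same dual covectors, so it is enough to compare coefficients: the
   constraint is tested on the basis control [delta_mx 0 a], which [ctrl] sends to the corresponding
   basis vector. *)
apply: eq_bigr => a _; apply: (congr1 (fun r : R => r *: _)).
apply: etrans (constraint (delta_mx 0 a)).
apply: (congr1 (pairing (xi t))).
exact/esym/(ctrl_delta (fun a : 'I_m => E (widen_ord hmn a))).
Qed.
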